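(* Let $\mathbb{K}$ be a local field, let $\psi$ and $\varphi$ be two wavelets (admissible wavelets on $\mathbb{K}$), and let $f,g$ be two functions belonging to $L^2(\mathbb{K})$. Then: (i) (Linearity) $K_\psi(\eta f+\vartheta g)(a,b)=\eta K_\psi(f)(a,b)+\vartheta K_\psi(g)(a,b)$, where $\eta$ and $\vartheta$ are any two scalars. (ii) (Shift property) $K_\psi\big(f(x-\varsigma)\big)(a,b)=K_\psi(f)(a,b-\varsigma)$, where $\varsigma$ is any scalar. (iii) (Scaling property) If $\sigma\neq0$ is any scalar, the continuous wavelet transform of the scaled function $f_\sigma(x)=\frac{1}{\sigma}f\left(\frac{x}{\sigma}\right)$ is $K_\psi(f_\sigma(x))(a,b)=K_\psi(f)\left(\frac{a}{\sigma},\frac{b}{\sigma}\right)$. (iv) (Symmetry) $K_\psi(f)(a,b)=\overline{K_f(\psi)\left(\frac1a,-\frac1b\right)}$. (v) (Parity) $K_{P(\psi)}(Pf)(a,b)=K_\psi(f)(a,-b)$, where $P$ is the parity operator defined by $Pf(x)=f(-x)$.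
   Context: A local field $\mathbb{K}$ is a locally compact, non-discrete, complete, totally disconnected topological field. $dx$ is a Haar measure on the additive group $\mathbb{K}^+$; the absolute value is defined by $d(\alpha x)=|\alpha|\,dx$ for $\alpha\ne0$, and $|0|=0$. Put $\mathfrak{D}=\{x\in\mathbb{K}:|x|\le 1\}$ and $\mathfrak{P}=\{x\in\mathbb{K}:|x|<1\}$. Fix a continuous unitary character $\chi$ of $\mathbb{K}^+$ that is trivial on $\mathfrak{D}$ but nontrivial on $\mathfrak{P}^{-1}$, and write $\chi_y(x)=\chi(xy)$. The Fourier transform is $\hat f(\xi)=\int_{\mathbb{K}} f(x)\overline{\chi_\xi(x)}\,dx$ for $f\in L^1(\mathbb{K})$, extended to $L^2(\mathbb{K})$. Functions are complex valued. A function $\psi\in L^2(\mathbb{K})$ is an admissible wavelet (mother wavelet) if $c_\psi=\int_{\mathbb{K}}\frac{|\hat\psi(\xi)|^2}{|\xi|}\,d\xi<\infty$. For $a,b\in\mathbb{K}$, $a\neq0$, the continuous wavelet transform of $f\in L^2(\mathbb{K})$ with respect to $\psi$ is $K_\psi(f)(a,b)=\int_{\mathbb{K}} f(x)\,|a|^{-1/2}\,\overline{\psi\left(\frac{x-b}{a}\right)}\,dx$. The expression $K_f(\psi)$ denotes the same formula with the roles of $f$ and $\psi$ exchanged.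
   Formalization: In (iii) 1/σ is not a complex scalar: the identity is proved with |σ|^{-1/2} in place of 1/σ, and with |σ|^{-1} the right side gains a factor |σ|^{-1/2}; in (iv) the printed -1/b, which is false in general, is corrected to -b/a. *)

(* Defs.v *)
From HB Require Import structures.
From mathcomp Require Import all_boot all_order all_algebra.
From mathcomp Require Import all_classical all_reals all_analysis.
From mathcomp Require Import complex.

Set Implicit Arguments.
Unset Strict Implicit.
Unset Printing Implicit Defensive.

Import Order.TTheory GRing.Theory Num.Theory.
Import numFieldTopology.Exports numFieldNormedType.Exports.

Local Open Scope classical_set_scope.
Local Open Scope ring_scope.
Local Open Scope complex_scope.

(* Completeness refers to the uniformity of the additive group: a uniformity for
   which addition and opposite are uniformly continuous (as required by
   [UniformZmodule]) is determined by the neighbourhoods of 0.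
   In MathComp 0^-1 = 0, whence the restriction in [inv_continuous]. *)
HB.mixin Record isLocalField K & UniformZmodule K & GRing.Field K := {
  mul_continuous : continuous (fun x : K * K => x.1 * x.2);
  inv_continuous : forall x : K, x != 0 -> {for x, continuous (@GRing.inv K)};
  local_field_locally_compact : locally_compact [set: K];
  local_field_nondiscrete : ~ (forall A : set K, open A);
  local_field_complete : forall F : set_system K,
    ProperFilter F -> cauchy F -> exists x : K, F --> x;
  local_field_totally_disconnected : totally_disconnected [set: K]
}.

#[short(type="localFieldType")]
HB.structure Definition LocalField :=
  {K of UniformZmodule K & GRing.Field K & isLocalField K}.

(* Seen as a mere zmodType, K is pointed (by 0), as [g_sigma_algebraType] needs. *)
Definition borel (K : localFieldType) :=
  g_sigma_algebraType (@open K : set (set (K : zmodType))).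

Record haar_measure (R : realType) (K : localFieldType)
    (mu : {measure set (borel K) -> \bar R}) : Prop := {
  haar_neq0 : mu [set: K] <> 0%E;
  haar_translate : forall (b : K) (A : set K),
    measurable (A : set (borel K)) -> mu [set b + x | x in A] = mu A;
  haar_compact : forall A : set K, compact A -> (mu A < +oo)%E;
  haar_outer_regular : forall A : set K, measurable (A : set (borel K)) ->
    mu A = ereal_inf [set mu U | U in [set U : set K | open U /\ A `<=` U]];
  haar_inner_regular : forall U : set K, open U ->
    mu U = ereal_sup [set mu C | C in [set C : set K | compact C /\ C `<=` U]]
}.

(* d(a x) = |a| dx; since mu is a Haar measure this determines abs. *)
Definition is_absolute_value (R : realType) (K : localFieldType)
    (mu : {measure set (borel K) -> \bar R}) (abs : K -> R) : Prop :=
  abs 0 = 0 /\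
  forall (a : K), a != 0 -> forall A : set K, measurable (A : set (borel K)) ->
    mu [set a * x | x in A] = ((abs a)%:E * mu A)%E.

Section WaveletTransform.
Context (R : realType) (K : localFieldType).
Variables (mu : {measure set (borel K) -> \bar R}) (abs : K -> R).
Variable chi : K -> R[i].

Definition ring_of_integers : set K := [set x | abs x <= 1].

Definition prime_ideal : set K := [set x | abs x < 1].

(* The inverse as a fractional ideal, not the set of inverses of elements. *)
Definition inverse_prime_ideal : set K :=
  [set x | forall y, prime_ideal y -> ring_of_integers (x * y)].

Record fourier_character : Prop := {
  chi_continuous : continuous (chi : K -> R[i]^o);
  chi_unitary : forall x, `|chi x| = 1;
  chi_add : forall x y, chi (x + y) = chi x * chi y;
  chi_trivial : forall x, ring_of_integers x -> chi x = 1;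
  chi_nontrivial : exists2 x, inverse_prime_ideal x & chi x <> 1
}.

Definition cmeasurable (f : K -> R[i]) : Prop :=
  measurable_fun [set: borel K] (fun x : borel K => complex.Re (f x)) /\
  measurable_fun [set: borel K] (fun x : borel K => complex.Im (f x)).

Definition cintegral (f : K -> R[i]) : R[i] :=
  (\int[mu]_x complex.Re (f x)) +i* (\int[mu]_x complex.Im (f x)).

Definition in_L1 (f : K -> R[i]) : Prop :=
  cmeasurable f /\ (\int[mu]_x (Normc.normc (f x))%:E < +oo)%E.

Definition in_L2 (f : K -> R[i]) : Prop :=
  cmeasurable f /\ (\int[mu]_x (Normc.normc (f x) ^+ 2)%:E < +oo)%E.

Definition L2_cvg (u : nat -> K -> R[i]) (f : K -> R[i]) : Prop :=
  (fun n => \int[mu]_x (Normc.normc (u n x - f x) ^+ 2)%:E)%E @ \oo --> 0%E.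

Definition fourier (f : K -> R[i]) (xi : K) : R[i] :=
  cintegral (fun x => f x * (chi (x * xi))^*).

(* Extension of [fourier] by continuity from L^1 /\ L^2 to L^2; the transform
   is only defined up to almost everywhere equality, hence a relation. *)
Definition is_L2_fourier (f fhat : K -> R[i]) : Prop :=
  [/\ in_L2 f, in_L2 fhat &
    exists u : nat -> K -> R[i],
      [/\ forall n, in_L1 (u n) /\ in_L2 (u n),
          L2_cvg u f &
          L2_cvg (fun n => fourier (u n)) fhat]].

Definition admissible_wavelet (psi : K -> R[i]) : Prop :=
  in_L2 psi /\
  exists2 psihat : K -> R[i], is_L2_fourier psi psihat &
    (\int[mu]_xi (Normc.normc (psihat xi) ^+ 2 / abs xi)%:E < +oo)%E.

Definition cwt (psi f : K -> R[i]) (a b : K) : R[i] :=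
  cintegral (fun x =>
    f x * (abs a `^ (- 2^-1))%:C * (psi ((x - b) / a))^*).

End WaveletTransform.

Definition parity (R : realType) (K : localFieldType) (f : K -> R[i]) :
  K -> R[i] := fun x => f (- x).

(* Main.v *)
(* Every item is a change of variables y = c x + d in the integral defining the
   transform: the Haar measure is translation invariant and scales by |c|, so
   such a substitution multiplies integrals by |c|^-1. The absolute value is
   multiplicative because some Borel set has positive finite measure, and then
   |-1| = 1 since |-1|^2 = |1|. Products of L^2 functions are integrable by
   |z w| <= |z|^2 + |w|^2. *)

Require Import Defs.
From HB Require Import structures.
From mathcomp Require Import all_boot all_order all_algebra.
From mathcomp Require Import all_classical all_reals all_analysis.
From mathcomp Require Import complex.
From mathcomp Require Import measurable_realfun ring lra.

Set Implicit Arguments.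
Unset Strict Implicit.
Unset Printing Implicit Defensive.

Import Order.TTheory GRing.Theory Num.Theory.
Import numFieldTopology.Exports numFieldNormedType.Exports.

Local Open Scope classical_set_scope.
Local Open Scope ring_scope.
Local Open Scope complex_scope.

(** * Topology of a local field and Borel measurability of affine maps *)

Lemma unif_continuous_continuous (U V : uniformType) (f : U -> V) :
  unif_continuous f -> continuous f.
Proof.
move=> uf x A; rewrite nbhs_simpl /= -!nbhs_entourageE => -[E entE EA].
exists ((fun xy => (f xy.1, f xy.2)) @^-1` E); first exact: uf.
by move=> y /xsectionP Exy; apply: EA; apply/xsectionP.
Qed.

Section LocalFieldTopology.
Context (K : localFieldType).

(** Connected components are closed and here reduce to points, so points are closed; a uniform space
    is regular, which upgrades this to Hausdorff. It serves to make compact sets Borel. *)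
Lemma local_field_hausdorff : hausdorff_space K.
Proof.
move=> p q pq; apply/eqP; rewrite -[_ == _]negbK; apply/negP => npq.
have cl1 : closed [set q].
  rewrite -(@local_field_totally_disconnected K q I).
  exact: component_closed closedT.
have : nbhs p (~` [set q]).
  apply: open_nbhs_nbhs; split; first exact: closed_openC.
  by move=> pq'; move: npq; rewrite pq' eqxx.
move=> /(@uniform_regular K p)[B Bp clB].
suff : closure B q by move/clB; apply.
by move=> C Cq; apply: pq.
Qed.

Lemma continuous_affine (c d : K) : continuous (fun x : K => c * x + d).
Proof.
move=> x; have /(_ (c * x, d)) addc :=
  unif_continuous_continuous (@add_unif_continuous K).
have /(_ (c, x)) mulc := @Defs.mul_continuous K.
apply: (@continuous2_cvg _ _ _ _ _ _ _ _ (fun x y : K => x + y)).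
- exact: addc.
- apply: (@continuous2_cvg _ _ _ _ _ _ _ _ (fun x y : K => x * y)).
  + exact: mulc.
  + exact: cvg_cst.
  + exact: cvg_id.
- exact: cvg_cst.
Qed.

Lemma measurable_affine (c d : K) :
  measurable_fun [set: borel K] (fun x : borel K => c * x + d : borel K).
Proof.
apply: (@measurability _ _ (borel K) (borel K) _ _ (@open K)) => //.
move=> _ [U oU <-]; rewrite setTI; apply: sub_sigma_algebra.
exact: (proj1 (continuousP _) (@continuous_affine c d)).
Qed.

End LocalFieldTopology.

(** * The absolute value as modulus of the Haar measure, and real affine substitutions *)

Section HaarIntegral.
Context (R : realType) (K : localFieldType).
Context (mu : {measure set (borel K) -> \bar R}) (abs : K -> R).
Hypothesis mu_haar : haar_measure mu.
Hypothesis absP : is_absolute_value mu abs.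

(** Multiplication by [a] maps K onto itself, so [mu K = |a| mu K]. As [mu K] may be infinite, the
    argument uses only its positivity, which excludes [|a| <= 0], and no cancellation. *)
Lemma abs_gt0 (a : K) : a != 0 -> 0 < abs a.
Proof.
move=> a0; have /(_ [set: K] measurableT) := absP.2 a a0.
have -> : [set a * x | x in [set: K]] = [set: K].
  by rewrite -subTset => x _; exists (a^-1 * x) => //; rewrite mulVKf.
have muT0 : (0 < mu [set: K])%E.
  by rewrite lt0e measure_ge0 andbT; apply/eqP/(haar_neq0 mu_haar).
rewrite ltNge; move=> muE; apply/negP => a_le0; move: muT0.
by rewrite muE ltNge mule_le0_ge0 ?lee_fin ?measure_ge0.
Qed.

(** Inner regularity on the whole space, whose measure is positive, yields a compact set of positive
    measure. Compactness makes that measure finite and, K being Hausdorff, makes the set closed,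
    hence Borel. *)
Lemma haar_exists_finite : exists A : set (borel K),
  [/\ measurable A, (0 < mu A)%E & (mu A < +oo)%E].
Proof.
have : (0 < mu [set: K])%E.
  by rewrite lt0e measure_ge0 andbT; apply/eqP/(haar_neq0 mu_haar).
rewrite (haar_inner_regular mu_haar openT).
move=> /ereal_sup_gt[_ [C [cC _] <-] muC0].
exists C; split => //; last exact: (haar_compact mu_haar cC).
rewrite -[C]setCK; apply: measurableC; apply: sub_sigma_algebra.
by apply: closed_openC; apply: compact_closed cC; exact: local_field_hausdorff.
Qed.

(** The image under multiplication by [a] is the preimage under multiplication by [a^-1], a
    measurable map. *)
Lemma measurable_scale (a : K) (A : set (borel K)) : a != 0 ->
  measurable A -> measurable ([set a * x | x in A] : set (borel K)).
Proof.
move=> a0 mA.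
rewrite (_ : [set _ | _ in _] = (fun x : K => a^-1 * x + 0) @^-1` A).
  by rewrite -[X in measurable X]setTI; exact: measurable_affine.
apply/seteqP; split => [_ [x Ax <-]|x /=]; first by rewrite /= mulKf// addr0.
by rewrite addr0 => Ax; exists (a^-1 * x) => //; rewrite mulVKf.
Qed.

Lemma absM (a b : K) : a != 0 -> b != 0 -> abs (a * b) = abs a * abs b.
Proof.
move=> a0 b0; have [A [mA A0 Aoo]] := haar_exists_finite.
have := absP.2 (a * b) (mulf_neq0 a0 b0) A mA.
have -> : [set a * b * x | x in A] = [set a * y | y in [set b * x | x in A]].
  apply/seteqP; split => [_ [x Ax <-]|_ [_ [x Ax <-] <-]]; last first.
    by exists x => //; rewrite mulrA.
  by exists (b * x); [exists x|rewrite mulrA].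
rewrite absP.2//; last exact: measurable_scale.
rewrite absP.2//; move: A0 Aoo.
case: (mu A) => // r; rewrite lte_fin => r0 _ [].
by rewrite mulrA => /(mulIf _)->//; rewrite gt_eqF.
Qed.

Lemma abs1 : abs 1 = 1.
Proof.
have a0 : abs 1 != 0 by rewrite gt_eqF// abs_gt0// oner_neq0.
by apply: (mulfI a0); rewrite -absM ?oner_neq0// !mulr1.
Qed.

Lemma absN1 : abs (-1) = 1.
Proof.
have n10 : (-1 : K) != 0 by rewrite oppr_eq0 oner_neq0.
apply/eqP; rewrite -(@eqrXn2 _ 2) ?ltW ?abs_gt0//.
by rewrite expr2 -absM// mulrNN mulr1 abs1 expr1n.
Qed.

Lemma absV (a : K) : a != 0 -> abs a^-1 = (abs a)^-1.
Proof.
move=> a0; have aa0 : abs a != 0 by rewrite gt_eqF// abs_gt0.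
by apply: (mulfI aa0); rewrite -absM ?invr_eq0// !mulfV// abs1.
Qed.

(** The preimage is [c^-1 (A - d)]: translation preserves the measure of [A], and the dilation
    contributes [|c^-1|]. *)
Lemma haar_preimage_affine (c d : K) (A : set (borel K)) : c != 0 ->
  measurable A ->
  mu ((fun x : K => c * x + d) @^-1` A) = ((abs c)^-1%:E * mu A)%E.
Proof.
move=> c0 mA; rewrite -absV//.
have -> : (fun x : K => c * x + d) @^-1` A =
    [set c^-1 * y | y in [set - d + x | x in A]].
  apply/seteqP; split => [x /= Ax|_ [_ [x Ax <-] <-]] /=; last first.
    by rewrite mulVKf// addrC addNKr.
  exists (c * x); last by rewrite mulKf.
  by exists (c * x + d) => //; rewrite addrC addrK.
rewrite absP.2 ?invr_eq0//; last first.
  rewrite (_ : [set _ | _ in _] = (fun x : K => 1 * x + d) @^-1` A).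
    by rewrite -[X in measurable X]setTI; exact: measurable_affine.
  apply/seteqP; split => [_ [x Ax <-]|x /=].
    by rewrite /= mul1r addrC addNKr.
  by rewrite mul1r => Ax; exists (x + d) => //; rewrite addrC addrK.
by rewrite (haar_translate mu_haar).
Qed.

(** The pushforward of [mu] under the affine map agrees with the measure [|c|^-1 mu] on Borel sets,
    so both give the same integrals. *)
Lemma ge0_integral_affine (c d : K) (h : borel K -> \bar R) : c != 0 ->
  measurable_fun [set: borel K] h -> (forall x, 0 <= h x)%E ->
  (\int[mu]_x h (c * (x : K) + d)%R = (abs c)^-1%:E * \int[mu]_x h x)%E.
Proof.
move=> c0 mh h0; have ca0 : 0 <= (abs c)^-1 by rewrite invr_ge0 ltW// abs_gt0.
have mphi := measurable_affine c d.
rewrite -(ge0_integral_mscale mu measurableT (NngNum ca0))//.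
rewrite -(@ge0_integral_pushforward _ _ _ _ _ _ mphi mu setT h)//.
by apply: eq_measure_integral => A mA _; exact: haar_preimage_affine.
Qed.

Lemma integrable_affine (c d : K) (h : borel K -> \bar R) : c != 0 ->
  mu.-integrable setT h -> mu.-integrable setT (fun x => h (c * (x : K) + d)%R).
Proof.
move=> c0 /integrableP[mh hoo]; apply/integrableP; split.
  exact: (measurableT_comp mh (measurable_affine c d)).
rewrite (@ge0_integral_affine c d (fun x => `|h x|%E))//.
  by rewrite lte_mul_pinfty ?lee_fin ?invr_ge0 ?ltW ?abs_gt0.
exact: measurableT_comp.
Qed.

(** The nonnegative case is applied to the positive and negative parts. Integrability keeps their
    difference from being oo - oo, so that the factor can be taken out. *)
Lemma Rintegral_affine (c d : K) (h : borel K -> R) : c != 0 ->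
  mu.-integrable setT (EFin \o h) ->
  \int[mu]_x h (c * (x : K) + d)%R = (abs c)^-1 * \int[mu]_x h x.
Proof.
move=> c0 ih; have mh := measurable_int _ ih.
have mp := measurable_funepos mh; have mn := measurable_funeneg mh.
rewrite -RintegralZl// /Rintegral; congr fine.
under [RHS]eq_integral do rewrite EFinM.
rewrite integralZl//.
transitivity ((abs c)^-1%:E * \int[mu]_x (EFin \o h)^\+ x -
              (abs c)^-1%:E * \int[mu]_x (EFin \o h)^\- x)%E.
  rewrite integralE; congr (_ - _)%E.
    rewrite -(ge0_integral_affine d c0 mp)//.
    by apply: eq_integral => x _; rewrite !funeposE.
  rewrite -(ge0_integral_affine d c0 mn)//.
  by apply: eq_integral => x _; rewrite !funenegE.
rewrite -muleBr//; first by rewrite [in RHS]integralE.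
exact: integrable_add_def.
Qed.

End HaarIntegral.

(** * Complex-valued integrals and products of L^2 functions *)

Lemma normc_sqr (R : realType) (z : R[i]) :
  Normc.normc z ^+ 2 = complex.Re z ^+ 2 + complex.Im z ^+ 2.
Proof. by case: z => x y /=; rewrite sqr_sqrtr// addr_ge0// sqr_ge0. Qed.

Section ComplexIntegral.
Context (R : realType) (K : localFieldType).
Context (mu : {measure set (borel K) -> \bar R}).

(** [cintegral] takes the finite parts of two extended real integrals, so its algebraic rules are
    proved under integrability of both components. *)
Definition cintegrable (f : K -> R[i]) : Prop :=
  mu.-integrable setT (fun x : borel K => (complex.Re (f x))%:E) /\
  mu.-integrable setT (fun x : borel K => (complex.Im (f x))%:E).

Lemma cintegrableZ (c : R[i]) (f : K -> R[i]) :
  cintegrable f -> cintegrable (fun x => c * f x).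
Proof.
case=> ref imf; split.
- rewrite (_ : (fun _ => _) =
    ((fun x : borel K => (complex.Re c)%:E * (complex.Re (f x))%:E)
    \- (fun x : borel K => (complex.Im c)%:E * (complex.Im (f x))%:E))%E).
    by apply: integrableB => //; exact: integrableZl.
  by apply/funext => x; case: c (f x) => [a b] [u v].
- rewrite (_ : (fun _ => _) =
    ((fun x : borel K => (complex.Re c)%:E * (complex.Im (f x))%:E)
    \+ (fun x : borel K => (complex.Im c)%:E * (complex.Re (f x))%:E))%E).
    by apply: integrableD => //; exact: integrableZl.
  by apply/funext => x; case: c (f x) => [a b] [u v].
Qed.

Lemma cintegralZ (c : R[i]) (f : K -> R[i]) :
  cintegrable f -> cintegral mu (fun x => c * f x) = c * cintegral mu f.
Proof.
case=> ref imf; have int_scale (k : R) (h : borel K -> R) :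
    mu.-integrable setT (EFin \o h) ->
    mu.-integrable setT (EFin \o (fun x => k * h x)).
  by move=> ih; have := integrableZl measurableT k ih.
rewrite /cintegral; case: c => a b.
transitivity ((\int[mu]_x (a * complex.Re (f x) - b * complex.Im (f x))) +i*
    (\int[mu]_x (a * complex.Im (f x) + b * complex.Re (f x)))).
  by congr (_ +i* _); apply: eq_Rintegral => x _; case: (f x).
by rewrite RintegralB ?RintegralD ?RintegralZl//; exact: int_scale.
Qed.

Lemma cintegralD (f g : K -> R[i]) : cintegrable f -> cintegrable g ->
  cintegral mu (fun x => f x + g x) = cintegral mu f + cintegral mu g.
Proof.
case=> ref imf [reg img]; rewrite /cintegral.
transitivity ((\int[mu]_x (complex.Re (f x) + complex.Re (g x))) +i*
    (\int[mu]_x (complex.Im (f x) + complex.Im (g x)))).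
  by congr (_ +i* _); apply: eq_Rintegral => x _; case: (f x) (g x) => ? ? [].
by rewrite !RintegralD.
Qed.

Lemma cintegral_conj (f : K -> R[i]) : cintegrable f ->
  cintegral mu (fun x => (f x)^*) = (cintegral mu f)^*.
Proof.
case=> ref imf; rewrite /cintegral /= -[in RHS]mulN1r -RintegralZl//.
by congr (_ +i* _); apply: eq_Rintegral => x _; case: (f x) => //= ? ?;
  rewrite mulN1r.
Qed.

Lemma in_L2_conj (f : K -> R[i]) : in_L2 mu f -> in_L2 mu (fun x => (f x)^*).
Proof.
move=> [[mre mim] foo]; split; first split.
- by rewrite (_ : (fun _ => _) = (fun x => complex.Re (f x)))//;
    apply/funext => x; case: (f x).
- rewrite (_ : (fun _ => _) = (fun x : borel K => - complex.Im (f x))).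
    exact: measurableT_comp.
  by apply/funext => x; case: (f x).
- rewrite (eq_integral (fun x : borel K => (Normc.normc (f x) ^+ 2)%:E))//.
  by move=> x _; rewrite !normc_sqr; case: (f x) => ? ? /=; rewrite sqrrN.
Qed.

(** The squared modulus is written as a polynomial in the real and imaginary parts, which turns the
    later domination estimates into polynomial inequalities. *)
Lemma in_L2_integrable_sqr (f : K -> R[i]) : in_L2 mu f ->
  mu.-integrable setT
    (fun x : borel K => (complex.Re (f x) ^+ 2 + complex.Im (f x) ^+ 2)%:E).
Proof.
move=> [[mre mim] foo]; apply/integrableP; split.
  apply/measurable_EFinP.
  by apply: measurable_funD; apply: measurable_funX.
apply: le_lt_trans foo; rewrite le_eqVlt; apply/orP; left; apply/eqP.
apply: eq_integral => x _; rewrite normc_sqr /= ger0_norm//.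
by rewrite addr_ge0// sqr_ge0.
Qed.

Lemma cintegrableM (f g : K -> R[i]) : in_L2 mu f -> in_L2 mu g ->
  cintegrable (fun x => f x * g x).
Proof.
move=> fL2 gL2.
have := integrableD measurableT (in_L2_integrable_sqr fL2)
  (in_L2_integrable_sqr gL2).
move: fL2 gL2 => [[mref mimf] _] [[mreg mimg] _] idom.
split; apply: le_integrable idom => //.
- apply/measurable_EFinP; rewrite (_ : (fun _ => _) = (fun x : borel K =>
    complex.Re (f x) * complex.Re (g x) - complex.Im (f x) * complex.Im (g x))).
    by apply: measurable_funB; apply: measurable_funM.
  by apply/funext => x; case: (f x) (g x) => ? ? [].
- move=> x _; rewrite -EFinD !abse_EFin lee_fin.
  case: (f x) (g x) => a b [c d] /=.
  rewrite [leRHS]ger0_norm ?addr_ge0 ?sqr_ge0//.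
  (* These squares give 2|ac| <= a^2 + c^2 and 2|bd| <= b^2 + d^2, which bound the real part ac -
     bd. *)
  have := (sqr_ge0 (a - c), sqr_ge0 (a + c), sqr_ge0 (b - d), sqr_ge0 (b + d)).
  move=> [[[h1 h2] h3] h4]; rewrite ler_norml; apply/andP; split; nra.
- apply/measurable_EFinP; rewrite (_ : (fun _ => _) = (fun x : borel K =>
    complex.Re (f x) * complex.Im (g x) + complex.Im (f x) * complex.Re (g x))).
    by apply: measurable_funD; apply: measurable_funM.
  by apply/funext => x; case: (f x) (g x) => ? ? [].
- move=> x _; rewrite -EFinD !abse_EFin lee_fin.
  case: (f x) (g x) => a b [c d] /=.
  rewrite [leRHS]ger0_norm ?addr_ge0 ?sqr_ge0//.
  (* The pairing is now crosswise, for the imaginary part ad + bc. *)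
  have := (sqr_ge0 (a - d), sqr_ge0 (a + d), sqr_ge0 (b - c), sqr_ge0 (b + c)).
  move=> [[[h1 h2] h3] h4]; rewrite ler_norml; apply/andP; split; nra.
Qed.

End ComplexIntegral.

(** * Affine substitutions for complex integrals and integrability of the wavelet integrand *)

Section WaveletTransformProperties.
Context (R : realType) (K : localFieldType).
Context (mu : {measure set (borel K) -> \bar R}) (abs : K -> R).
Hypothesis mu_haar : haar_measure mu.
Hypothesis absP : is_absolute_value mu abs.

Lemma cintegral_affine (c d : K) (f : K -> R[i]) : c != 0 ->
  cintegrable mu f ->
  cintegral mu (fun x => f (c * x + d)) = ((abs c)^-1)%:C * cintegral mu f.
Proof.
move=> c0 [ref imf]; rewrite /cintegral.
have /= -> := Rintegral_affine mu_haar absP d c0 ref.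
have /= -> := Rintegral_affine mu_haar absP d c0 imf.
by apply/eqP; rewrite eq_complex /= !mul0r subr0 addr0 !eqxx.
Qed.

Lemma cintegrable_affine (c d : K) (f : K -> R[i]) : c != 0 ->
  cintegrable mu f -> cintegrable mu (fun x => f (c * x + d)).
Proof.
move=> c0 [ref imf]; split.
- exact: (integrable_affine mu_haar absP d c0 ref).
- exact: (integrable_affine mu_haar absP d c0 imf).
Qed.

Lemma in_L2_affine (c d : K) (f : K -> R[i]) : c != 0 ->
  in_L2 mu f -> in_L2 mu (fun x => f (c * x + d)).
Proof.
move=> c0 [[mre mim] foo]; split; first split.
- exact: (measurableT_comp mre (measurable_affine c d)).
- exact: (measurableT_comp mim (measurable_affine c d)).
pose h (x : borel K) := (Normc.normc (f x) ^+ 2)%:E.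
have mh : measurable_fun [set: borel K] h.
  apply/measurable_EFinP; under eq_fun do rewrite normc_sqr.
  by apply: measurable_funD; apply: measurable_funX.
have h0 x : (0 <= h x)%E by rewrite lee_fin sqr_ge0.
have /= -> := ge0_integral_affine mu_haar absP d c0 mh h0.
by rewrite lte_mul_pinfty// lee_fin invr_ge0 ltW// (abs_gt0 mu_haar absP).
Qed.

(** Up to the constant [k], the integrand is the product of [f] and the conjugate of [psi] composed
    with x -> x/a - b/a, both in L^2. *)
Lemma cwt_cintegrable (psi f : K -> R[i]) (k : R[i]) (a b : K) : a != 0 ->
  in_L2 mu psi -> in_L2 mu f ->
  cintegrable mu (fun x => f x * k * (psi ((x - b) / a))^*).
Proof.
move=> a0 psiL2 fL2.
rewrite (_ : (fun _ => _) =
  (fun x => k * (f x * (psi (a^-1 * x + - (b / a)))^*))); last first.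
  apply/funext => x; rewrite mulrA [k * _]mulrC; congr (_ * (psi _)^*).
  by rewrite mulrBl mulrC.
apply/cintegrableZ/cintegrableM => //; apply/in_L2_conj/in_L2_affine => //.
by rewrite invr_eq0.
Qed.

End WaveletTransformProperties.

(** * The five properties of the transform *)

Theorem theorem3p1 (R : realType) (K : localFieldType)
    (mu : {measure set (borel K) -> \bar R}) (mu_haar : haar_measure mu)
    (abs : K -> R) (absP : is_absolute_value mu abs)
    (chi : K -> R[i]) (chiP : fourier_character abs chi)
    (psi phi : K -> R[i])
    (psi_wavelet : admissible_wavelet mu abs chi psi)
    (phi_wavelet : admissible_wavelet mu abs chi phi)
    (f g : K -> R[i]) (fL2 : in_L2 mu f) (gL2 : in_L2 mu g) :
  (forall (eta theta : R[i]) (a b : K), a != 0 ->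
     cwt mu abs psi (fun x => eta * f x + theta * g x) a b =
     eta * cwt mu abs psi f a b + theta * cwt mu abs psi g a b) /\
  (forall (s a b : K), a != 0 ->
     cwt mu abs psi (fun x => f (x - s)) a b = cwt mu abs psi f a (b - s)) /\
  (* 1 / sigma lies in K and cannot multiply a complex value: both the L^2
     normalisation |sigma|^(-1/2) and the L^1 normalisation |sigma|^-1 *)
  (forall (sigma a b : K), sigma != 0 -> a != 0 ->
     cwt mu abs psi (fun x => (abs sigma `^ (- 2^-1))%:C * f (x / sigma)) a b =
       cwt mu abs psi f (a / sigma) (b / sigma) /\
     cwt mu abs psi (fun x => ((abs sigma)^-1)%:C * f (x / sigma)) a b =
       (abs sigma `^ (- 2^-1))%:C *
       cwt mu abs psi f (a / sigma) (b / sigma)) /\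
  (forall (a b : K), a != 0 ->
     cwt mu abs psi f a b = (cwt mu abs f psi (1 / a) (- b / a))^*) /\
  (forall (a b : K), a != 0 ->
     cwt mu abs (parity psi) (parity f) a b = cwt mu abs psi f a (- b)).
Proof.
have psiL2 := psi_wavelet.1.
have abs0 := abs_gt0 mu_haar absP.
(* Every normalising factor is expressed through the positive square root of the absolute value, so
   that comparing factors becomes rational arithmetic. *)
have r0 (a : K) : a != 0 -> 0 < abs a `^ 2^-1 by move=> /abs0; exact: powR_gt0.
have rN (a : K) : abs a `^ (- 2^-1) = (abs a `^ 2^-1)^-1 by rewrite powRN.
have rr (a : K) : a != 0 -> abs a = abs a `^ 2^-1 * abs a `^ 2^-1.
  move=> a0; rewrite -powRD ?(gt_eqF (abs0 _ a0)) ?implybT//.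
  have -> : 2^-1 + 2^-1 = 1 :> R by lra.
  by rewrite powRr1// ltW// abs0.
have rV (a : K) : a != 0 -> abs a^-1 `^ 2^-1 = (abs a `^ 2^-1)^-1.
  move=> a0; rewrite (absV mu_haar absP)// -powR_inv1 ?ltW ?abs0//.
  by rewrite -powRrM mulN1r powRN.
have rM (a b : K) : a != 0 -> b != 0 ->
    abs (a * b) `^ 2^-1 = abs a `^ 2^-1 * abs b `^ 2^-1.
  by move=> a0 b0; rewrite (absM mu_haar absP)// powRM ?ltW ?abs0.
have realcM (x y : R) : (x * y)%:C = x%:C * y%:C :> R[i] by exact: rmorphM.
have conjM (x y : R[i]) : Num.conj (x * y) = Num.conj x * Num.conj y.
  exact: rmorphM.
(* [^*] elaborates to [conjc] in the statement but to [Num.conj] in [cwt]. *)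
have conjcE (x : R[i]) : conjc x = Num.conj x by [].
have conjR (x : R) : Num.conj (x%:C : R[i]) = x%:C by exact: conjc_real.
have wint := cwt_cintegrable mu_haar absP.
split; [|split; [|split; [|split]]].
- move=> eta theta a b a0; rewrite /cwt -!cintegralZ; try exact: wint.
  rewrite -cintegralD; try (apply: cintegrableZ; exact: wint).
  by congr cintegral; apply/funext => x; ring.
- move=> s a b a0; rewrite /cwt.
  (* Substituting x - s for x in the transform at [b - s] restores the wavelet argument (x -
     b)/a. *)
  have := cintegral_affine mu_haar absP (- s) (oner_neq0 K)
    (wint psi f (abs a `^ (- 2^-1))%:C a (b - s) a0 psiL2 fL2).
  rewrite (abs1 mu_haar absP) invr1 mul1r => <-.
  congr cintegral; apply/funext => x; rewrite mul1r; congr (_ * (psi _)^*).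
  by congr (_ / _); ring.
- move=> sigma a b s0 a0.
  have Vs0 : sigma^-1 != 0 by rewrite invr_eq0.
  have as0 : a / sigma != 0 by rewrite mulf_neq0.
  (* An arbitrary real factor [k] treats both normalisations at once: |sigma|^(-1/2) makes the outer
     factor 1, and |sigma|^-1 makes it |sigma|^(-1/2). *)
  have scaled (k : R) : cwt mu abs psi (fun x => k%:C * f (x / sigma)) a b =
      (k * abs sigma `^ 2^-1)%:C * cwt mu abs psi f (a / sigma) (b / sigma).
    have wi := wint psi f (abs (a / sigma) `^ (- 2^-1))%:C _ (b / sigma)
      as0 psiL2 fL2.
    have cov := cintegral_affine mu_haar absP 0 Vs0 wi.
    rewrite (absV mu_haar absP)// invrK (rr sigma)// in cov.
    have rs0 := lt0r_neq0 (r0 _ s0); have ra0 := lt0r_neq0 (r0 _ a0).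
    (* The factor is split in two: |sigma| comes from substituting x/sigma for x, and k
       |sigma|^(-1/2) accounts for exchanging |a/sigma|^(-1/2) with |a|^(-1/2). *)
    transitivity ((k / abs sigma `^ 2^-1)%:C *
      ((abs sigma `^ 2^-1 * abs sigma `^ 2^-1)%:C *
        cwt mu abs psi f (a / sigma) (b / sigma))); last first.
      by rewrite mulrA -realcM; congr (_%:C * _); field.
    rewrite /cwt -cov -cintegralZ; last first.
      exact: (cintegrable_affine mu_haar absP 0 Vs0 wi).
    congr cintegral; apply/funext => x; rewrite addr0 [sigma^-1 * x]mulrC.
    have -> : (x / sigma - b / sigma) / (a / sigma) = (x - b) / a.
      by field; rewrite a0 s0.
    rewrite !rN rM// rV//.
    transitivity ((k / abs a `^ 2^-1)%:C * f (x / sigma) *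
      (psi ((x - b) / a))^*).
      by rewrite realcM; ring.
    have -> : k / abs a `^ 2^-1 =
        k / abs sigma `^ 2^-1 * (abs a `^ 2^-1 / abs sigma `^ 2^-1)^-1.
      by field; rewrite rs0 ra0.
    by rewrite realcM; ring.
  have rs0 := lt0r_neq0 (r0 _ s0).
  split; rewrite scaled rN; first by rewrite mulVf// mul1r.
  by congr (_%:C * _); rewrite {1}rr//; field.
- move=> a b a0; rewrite /cwt -cintegral_conj; last first.
    by apply: wint => //; rewrite mul1r invr_eq0.
  have aa0 : abs a != 0 by rewrite gt_eqF// abs0.
  have wi := wint psi f (abs a `^ (- 2^-1))%:C a b a0 psiL2 fL2.
  have cov := cintegral_affine mu_haar absP b a0 wi.
  (* Substituting a x + b for x leaves [psi] at x, and the resulting |a| |a|^(-1/2) equals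
     |1/a|^(-1/2). The parameters 1/a and -b/a on the other side put [f] at (x + b/a) a = a x + b as
     well. *)
  transitivity ((abs a)%:C * cintegral mu (fun x =>
      f (a * x + b) * (abs a `^ (- 2^-1))%:C * (psi ((a * x + b - b) / a))^*)).
    by rewrite cov mulrA -realcM mulfV// mul1r.
  rewrite -cintegralZ; last first.
    exact: (cintegrable_affine mu_haar absP b a0 wi).
  congr cintegral; apply/funext => x.
  have -> : (a * x + b - b) / a = x by field.
  have -> : (x - - b / a) / (1 / a) = a * x + b.
    by rewrite mul1r invrK; field.
  have ra0 := lt0r_neq0 (r0 _ a0).
  rewrite !conjcE !conjM conjCK conjR mul1r !rN rV// invrK.
  rewrite {1}(rr a)//.
  transitivity ((abs a `^ 2^-1 * abs a `^ 2^-1 / abs a `^ 2^-1)%:C *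
    f (a * x + b) * (psi x)^*); first by rewrite realcM; ring.
  by rewrite mulfK//; ring.
- move=> a b a0; rewrite /cwt.
  have n10 : (-1 : K) != 0 by rewrite oppr_eq0 oner_neq0.
  (* The substitution x -> -x has factor |-1| = 1, and -((x - b)/a) = (-x - (-b))/a. *)
  have := cintegral_affine mu_haar absP 0 n10
    (wint psi f (abs a `^ (- 2^-1))%:C a (- b) a0 psiL2 fL2).
  rewrite (absN1 mu_haar absP) invr1 mul1r => <-.
  congr cintegral; apply/funext => x; rewrite /parity addr0 mulN1r.
  by congr (_ * (psi _)^*); rewrite -mulNr; congr (_ / _); ring.
Qed.
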